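(* Let $s\in\mathbb{R}$ and let $(\Lambda_{s},\eta_{s})$ be a $T$-transform of an isothermic surface $(\Lambda,\eta)$ in $S^n$, defined by the gauge transformation $\Phi_s$. If $(\Lambda,\eta)$ is a special isothermic surface of type $d\in\mathbb{N}_{0}$ with respect to a polynomial $p(t)$, then $(\Lambda_{s},\eta_{s})$ is a special isothermic surface of type $d$, with respect to a polynomial with constant term equal to $\Phi_{s}(p(s))$.
   Context: Let $n\ge 3$. $\mathbb{R}^{n+1,1}$ denotes $\mathbb{R}^{n+2}$ with an inner product $(\cdot,\cdot)$ of signature $(n+1,1)$, $\mathcal{L}$ its light-cone, and $S^n\cong\mathbb{P}(\mathcal{L})$. $\Sigma$ is a connected smooth surface, $\underline{\mathbb{R}}^{n+1,1}=\Sigma\times\mathbb{R}^{n+1,1}$, and $\mathrm{d}$ is its trivial flat connection. A map $\Sigma\to S^n$ is identified with a null line subbundle $\Lambda\subset\underline{\mathbb{R}}^{n+1,1}$; a lift of $\Lambda$ is a never-vanishing section $F$; $\Lambda$ is an immersion iff $\langle F,\mathrm{d}F(T\Sigma)\rangle$ is a subbundle of rank $3$. Identify $\bigwedge^2\mathbb{R}^{n+1,1}$ with $\mathrm{o}(\mathbb{R}^{n+1,1})$ by $(u\wedge v)w=(u,w)v-(v,w)u$. An isothermic surface $(\Lambda,\eta)$ in $S^n$ is an immersion $\Lambda$ with a non-zero closed $1$-form $\eta\in\Omega^1\otimes\mathrm{o}(\mathbb{R}^{n+1,1})$ taking values in $\Lambda\wedge\Lambda^{\perp}$; then $\mathrm{d}+t\eta$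 is a flat metric connection for all $t\in\mathbb{R}$. A polynomial conserved quantity of $(\Lambda,\eta)$ is a non-zero polynomial $p(t)=\sum_k p_kt^k$ with $p_k\in\Gamma(\underline{\mathbb{R}}^{n+1,1})$ such that $(\mathrm{d}+t\eta)p(t)=0$ for all $t$. $(\Lambda,\eta)$ is special isothermic of type $d$ with respect to $p(t)$ if $p(t)$ is a polynomial conserved quantity of degree $d$. $T$-transforms: since $\mathrm{d}+s\eta$ is flat and metric, there is locally (shrinking $\Sigma$ if necessary) an orthogonal gauge transformation $\Phi_s$ of $\underline{\mathbb{R}}^{n+1,1}$ with $\Phi_s\circ(\mathrm{d}+s\eta)\circ\Phi_s^{-1}=\mathrm{d}$. The $T$-transform of $(\Lambda,\eta)$ is $(\Lambda_s,\eta_s)$ with $\Lambda_s=\Phi_s\Lambda$ and $\eta_s=\mathrm{Ad}(\Phi_s)\eta=\Phi_s\circ\eta\circ\Phi_s^{-1}$; it is known to be isothermic with $\Phi_s\circ(\mathrm{d}+(t+s)\eta)\circ\Phi_s^{-1}=\mathrm{d}+t\eta_s$ for all $t\in\mathbb{R}$. *)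

(* Defs.v *)
From HB Require Import structures.
From mathcomp Require Import all_boot all_order all_algebra.
From mathcomp Require Import all_classical all_reals all_analysis.
Import Order.TTheory GRing.Theory Num.Theory.
Import numFieldNormedType.Exports.

Set Implicit Arguments.
Unset Strict Implicit.
Unset Printing Implicit Defensive.

Local Open Scope classical_set_scope.
Local Open Scope ring_scope.

Section Smoothness.
Context {R : realType} {U V : normedModType R}.

(* Only meaningful for open [O]: the iterated directional derivatives of [f] at
   the points of [O] then do not depend on the values of [f] outside [O]. *)
Fixpoint differentiable_upto (k : nat) (O : set U) (f : U -> V) : Prop :=
  match k with
  | 0 => forall x, O x -> {for x, continuous f}
  | k'.+1 => (forall x, O x -> differentiable f x) /\
             (forall v : U, differentiable_upto k' O ('D_v f))
  end.

Definition Cinfty_on (O : set U) (f : U -> V) : Prop :=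
  forall k, differentiable_upto k O f.

End Smoothness.

(* [chart i] and [param i] are total functions, but only their restrictions to
   [dom i] and to its image [chart i @` dom i] matter. *)
Record smooth_surface (R : realType) (S : topologicalType) := SmoothSurface {
  atlas : Type ;
  dom : atlas -> set S ;
  chart : atlas -> S -> 'rV[R]_2 ;
  param : atlas -> 'rV[R]_2 -> S ;
  dom_open : forall i, open (dom i) ;
  image_open : forall i, open (chart i @` dom i) ;
  chartK : forall i x, dom i x -> param i (chart i x) = x ;
  chart_continuous : forall i x, dom i x -> {for x, continuous (chart i)} ;
  param_continuous : forall i y, (chart i @` dom i) y ->
    {for y, continuous (param i)} ;
  dom_cover : forall x, exists i, dom i x ;
  transition_smooth : forall i j,
    Cinfty_on (chart i @` (dom i `&` dom j)) (chart j \o param i) ;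
  surface_hausdorff : hausdorff_space S ;
  surface_second_countable : @second_countable S
}.

Section Calculus.
Context {R : realType} {S : topologicalType} (M : smooth_surface R S).
Context {V : normedModType R}.

Definition smooth_on (W : set S) (f : S -> V) : Prop :=
  forall i : atlas M, Cinfty_on (chart i @` (W `&` dom i)) (f \o param i).

Definition smooth (f : S -> V) : Prop := smooth_on setT f.

(* A V-valued 1-form [w]: for [x] in [dom i], [w i x v] is its value on the
   tangent vector at [x] whose coordinates in the chart [i] are [v]; nothing is
   required outside [dom i]. *)
Definition form_data := atlas M -> S -> 'rV[R]_2 -> V.

Definition is_one_form (w : form_data) : Prop :=
  [/\ forall i x, dom i x -> forall (a : R) (u v : 'rV[R]_2),
        w i x (a *: u + v) = a *: w i x u + w i x v,
      forall i j x, dom i x -> dom j x -> forall v : 'rV[R]_2,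
        w j x ('D_v (chart j \o param i) (chart i x)) = w i x v
    & forall i (v : 'rV[R]_2),
        Cinfty_on (chart i @` dom i) (fun y => w i (param i y) v)].

(* dw = 0, evaluated on pairs of constant coordinate vector fields. *)
Definition closed_form (w : form_data) : Prop :=
  forall i x, dom i x -> forall u v : 'rV[R]_2,
    'D_u (fun y => w i (param i y) v) (chart i x) =
    'D_v (fun y => w i (param i y) u) (chart i x).

Definition nonzero_form (w : form_data) : Prop :=
  exists i x v, dom i x /\ w i x v <> 0.

Definition d_form (f : S -> V) : form_data :=
  fun i x v => 'D_v (f \o param i) (chart i x).

End Calculus.

Section Lorentz.
Context {R : realType} {n : nat}.

(* The inner product on the column space R^(n+2) with Gram matrix [G]. *)
Definition ip (G : 'M[R]_n.+2) (u v : 'cV[R]_n.+2) : R :=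
  (u^T *m G *m v) ord0 ord0.

(* Signature (n+1,1): there is a basis (the columns of [P]) in which the Gram
   matrix is diag(1, ..., 1, -1). *)
Definition lorentzian (G : 'M[R]_n.+2) : Prop :=
  exists2 P : 'M[R]_n.+2, P \in unitmx &
    P^T *m G *m P =
    diag_mx (\row_(i < n.+2) (if i == ord_max then -1 else 1)).

(* The matrix of w |-> (u,w) v - (v,w) u. *)
Definition wedge (G : 'M[R]_n.+2) (u v : 'cV[R]_n.+2) : 'M[R]_n.+2 :=
  v *m (u^T *m G) - u *m (v^T *m G).

Definition in_o (G A : 'M[R]_n.+2) : Prop :=
  forall u v, ip G (A *m u) v + ip G u (A *m v) = 0.

Definition perp (G : 'M[R]_n.+2) (L : {vspace 'cV[R]_n.+2}) :
    set 'cV[R]_n.+2 :=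
  [set v | forall u, u \in L -> ip G u v = 0].

(* For a line [L] the decomposable elements already form the whole linear
   subspace L /\ L^perp. *)
Definition in_wedge_perp (G : 'M[R]_n.+2) (L : {vspace 'cV[R]_n.+2})
    (A : 'M[R]_n.+2) : Prop :=
  exists u v, [/\ u \in L, perp G L v & A = wedge G u v].

End Lorentz.

Section Isothermic.
Context {R : realType} {n : nat} (G : 'M[R]_n.+2).
Context {S : topologicalType} (M : smooth_surface R S).

Definition bundle_section : Type := S -> 'cV[R]_n.+2.
Definition line_field : Type := S -> {vspace 'cV[R]_n.+2}.
Definition o_form : Type := @form_data R S M 'M[R]_n.+2.

Definition lift_on (W : set S) (L : line_field) (F : bundle_section) : Prop :=
  smooth_on M W F /\ (forall x, W x -> F x != 0 /\ F x \in L x).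

Definition null_line_bundle (L : line_field) : Prop :=
  [/\ forall x, \dim (L x) = 1%N,
      forall x u, u \in L x -> ip G u u = 0
    & forall x, exists W F, [/\ open W, W x & lift_on W L F]].

(* Lifts are taken locally, since a global one need not exist. *)
Definition immersion (L : line_field) : Prop :=
  null_line_bundle L /\
  forall W F, open W -> lift_on W L F ->
    forall i x, W x -> dom i x ->
      \dim (<[F x]> + <[d_form (M := M) F i x (delta_mx 0%R 0%R)]>
                    + <[d_form (M := M) F i x (delta_mx 0%R 1%R)]>)%VS = 3%N.

Definition isothermic (L : line_field) (eta : o_form) : Prop :=
  immersion L /\
  [/\ is_one_form eta, closed_form eta, nonzero_form eta,
      forall i x v, dom i x -> in_o G (eta i x v)
    & forall i x v, dom i x -> in_wedge_perp G (L x) (eta i x v)].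

(* d + t eta *)
Definition connection (t : R) (eta : o_form) (f : bundle_section) :
    @form_data R S M 'cV[R]_n.+2 :=
  fun i x v => d_form (M := M) f i x v + t *: (eta i x v *m f x).

(* Polynomials p_0 + p_1 t + ... with coefficients in the sections, as finite
   sequences of coefficients; trailing zero coefficients are allowed. *)
Definition pcoef (p : seq bundle_section) (k : nat) : bundle_section :=
  nth (fun _ => 0) p k.

Definition peval (p : seq bundle_section) (t : R) : bundle_section :=
  fun x => \sum_(k < size p) t ^+ k *: pcoef p k x.

Definition has_degree (p : seq bundle_section) (d : nat) : Prop :=
  (exists x, pcoef p d x <> 0) /\
  (forall k, (d < k)%N -> forall x, pcoef p k x = 0).

Definition conserved_quantity (eta : o_form) (p : seq bundle_section) : Prop :=
  [/\ exists k x, pcoef p k x <> 0,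
      forall k, smooth M (pcoef p k)
    & forall (t : R) i x v, dom i x -> connection t eta (peval p t) i x v = 0].

Definition special_isothermic (L : line_field) (eta : o_form) (d : nat)
    (p : seq bundle_section) : Prop :=
  [/\ isothermic L eta, conserved_quantity eta p & has_degree p d].

Definition orthogonal_gauge (Phi : S -> 'M[R]_n.+2) : Prop :=
  smooth M Phi /\
  forall x u v, ip G (Phi x *m u) (Phi x *m v) = ip G u v.

(* Phi o (d + s eta) o Phi^-1 = d, as operators on smooth sections. *)
Definition trivializes (s : R) (eta : o_form) (Phi : S -> 'M[R]_n.+2) : Prop :=
  forall f : bundle_section, smooth M f -> forall i x v, dom i x ->
    Phi x *m connection s eta (fun y => invmx (Phi y) *m f y) i x v =
    d_form (M := M) f i x v.

Definition gauge_line (Phi : S -> 'M[R]_n.+2) (L : line_field) : line_field :=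
  fun x => (linfun (mulmx (Phi x) : 'cV[R]_n.+2 -> 'cV[R]_n.+2) @: L x)%VS.

Definition gauge_form (Phi : S -> 'M[R]_n.+2) (eta : o_form) : o_form :=
  fun i x v => Phi x *m eta i x v *m invmx (Phi x).

Definition T_transform (s : R) (Phi : S -> 'M[R]_n.+2)
    (L : line_field) (eta : o_form) (Ls : line_field) (etas : o_form) : Prop :=
  [/\ orthogonal_gauge Phi, trivializes s eta Phi,
      Ls = gauge_line Phi L & etas = gauge_form Phi eta].

End Isothermic.

Arguments bundle_section R n S : clear implicits.
Arguments line_field R n S : clear implicits.
Arguments o_form {R} n {S} M.

(* Main.v *)
Require Import Defs.
From HB Require Import structures.
From mathcomp Require Import all_boot all_order all_algebra.
From mathcomp Require Import all_classical all_reals all_analysis.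
From mathcomp Require Import ring.
Import Order.TTheory GRing.Theory Num.Theory.
Import numFieldNormedType.Exports.
Local Open Scope classical_set_scope.
Local Open Scope ring_scope.

(** Write Psi for the pointwise inverse of the gauge transformation Phi.
    The condition on Phi, tested on constant sections, says
    d Psi = - s eta Psi, hence d Phi = s Phi eta, and the product rule gives
      (d + t eta_s) o Phi = Phi o (d + (t + s) eta)   for all t
    ([gauge_connection]).  So if p is conserved for eta, then
    q(t) = Phi p(t + s) is conserved for eta_s.  Its coefficients are Phi
    applied to the Taylor coefficients of p at s: the constant one is
    Phi p(s), and the top one is Phi p_d, so the degree does not change.

    The transform must also be shown to be isothermic.  Two algebraic facts
    about the values of eta in L /\ L^perp, for a null line L, do this.
    Such endomorphisms kill L ([in_wedge_perp_kills]); hence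
    d (Phi F) = Phi (d F) for every lift F of the original line bundle, and the
    immersion condition is transported by Phi.  They also commute with each
    other ([in_wedge_perp_comm]), so the derivatives of Phi and Psi contribute
    to d eta_s only commutators that vanish, and eta_s is closed because eta is.
    The remaining conditions hold because Phi is an isometry at each point.

    Smoothness needs the iterated directional derivatives to be stable under
    products of matrices ([differentiable_upto_bilinear]).  The inverse of Phi
    is not differentiated as an inverse: since Phi is orthogonal, it equals
    G^-1 Phi^T G, which is linear in Phi. *)

(** * Maps with iterated derivatives on an open set *)

Section UptoClosure.
Set Implicit Arguments.
Unset Strict Implicit.
Context {R : realType} {U : normedModType R}.
Implicit Types (O : set U) (k : nat).

(** The difference of the two maps vanishes near the point, so it is its own
    littleo remainder. *)
Lemma near_eq_differentiable {V : normedModType R} (f g : U -> V) x :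
  (\near x, f x = g x) -> differentiable f x -> differentiable g x.
Proof.
move=> fg df; pose h := g \- f.
have h0 : h \o shift x = cst (h x) + \0 +o_ 0 id.
  apply/eqaddoP => _ /posnumP[e].
  have : \forall y \near x, h y = 0.
    by near=> y; rewrite /h /= (near fg y) ?subrr.
  rewrite (near_shift 0 x) subr0 => h0; near=> y.
  have hy : h (y + x) = 0 by near: y.
  have hx : h x = 0 by rewrite /h /= (nbhs_singleton fg) subrr.
  by rewrite !fctE /= hy hx addr0 subrr normr0 mulr_ge0.
have dh : differentiable h x.
  apply/diff_locallyP.
  have -> : 'd h x = \0 :> (U -> V).
    by apply: diff_unique => //; exact: cst_continuous.
  by split => //; exact: cst_continuous.
rewrite (_ : g = f + h); first exact: differentiableD.
by apply/funext => y; rewrite /h /= !fctE addrC subrK.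
Unshelve. all: by end_near. Qed.

(** Openness makes this work: at a point of [O] every iterated derivative is
    computed from values in [O].  It allows derivatives to be replaced by
    formulas that are valid only on [O]. *)
Lemma differentiable_upto_ext {V : normedModType R} k O (f g : U -> V) :
  open O -> (forall x, O x -> f x = g x) ->
  differentiable_upto k O f -> differentiable_upto k O g.
Proof.
move=> oO; have near_of (h h' : U -> V) x : (forall y, O y -> h y = h' y) ->
    O x -> \forall y \near x, h y = h' y.
  by move=> hh' Ox; apply: filterS (open_nbhs_nbhs (conj oO Ox)).
elim: k f g => [|k IH] f g fg.
  move=> cf x Ox; have := cf x Ox; rewrite /prop_for /continuous_at -(fg x Ox).
  by apply: cvg_trans; apply: near_eq_cvg; exact: near_of.
move=> [df Df]; split=> [x Ox|v].
  by apply: near_eq_differentiable (df x Ox); exact: near_of.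
by apply: IH (Df v) => x Ox; apply: near_eq_derive; exact: near_of.
Qed.

Lemma differentiable_upto_sub {V : normedModType R} k O O' (f : U -> V) :
  O' `<=` O -> differentiable_upto k O f -> differentiable_upto k O' f.
Proof.
move=> sub; elim: k f => [f hf x /sub|k IH f [df Df]]; first exact: hf.
by split=> [x /sub|v]; [exact: df | exact: IH (Df v)].
Qed.

Lemma differentiable_upto_continuous {V : normedModType R} k O (f : U -> V) x :
  differentiable_upto k O f -> O x -> {for x, continuous f}.
Proof.
case: k => [|k]; first by move=> h /h.
by move=> [h _] /h; exact: differentiable_continuous.
Qed.

Lemma differentiable_uptoW {V : normedModType R} k O (f : U -> V) :
  differentiable_upto k.+1 O f -> differentiable_upto k O f.
Proof.
elim: k f => [|k IH] f hf.
  by move=> x; exact: differentiable_upto_continuous hf.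
have [df Df] := hf.
by split=> // v; exact/IH/Df.
Qed.

Lemma differentiable_bilinear_comp {U' V W : normedModType R}
    (B : {bilinear U' -> V -> W}) (f : U -> U') (g : U -> V) x :
  continuous (fun p => B p.1 p.2) ->
  differentiable f x -> differentiable g x ->
  differentiable (fun y => B (f y) (g y)) x.
Proof.
move=> cB df dg.
apply: (@differentiable_comp _ _ _ _ (fun y => (f y, g y)) (fun p => B p.1 p.2)).
  exact: differentiable_pair.
exact: differentiable_bilin.
Qed.

Lemma derive_bilinear {U' V W : normedModType R}
    (B : {bilinear U' -> V -> W}) (f : U -> U') (g : U -> V) x v :
  continuous (fun p => B p.1 p.2) ->
  differentiable f x -> differentiable g x ->
  'D_v (fun y => B (f y) (g y)) x = B ('D_v f x) (g x) + B (f x) ('D_v g x).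
Proof.
move=> cB df dg.
rewrite !deriveE //; last exact: differentiable_bilinear_comp.
rewrite (@diff_comp _ _ _ _ (fun y => (f y, g y)) (fun p => B p.1 p.2)) /=.
- by rewrite diff_bilin //= diff_pair //= addrC.
- exact: differentiable_pair.
- exact: differentiable_bilin.
Qed.

Lemma differentiable_upto_lincomb {V : normedModType R} k O (a : R)
    (f g : U -> V) : open O ->
  differentiable_upto k O f -> differentiable_upto k O g ->
  differentiable_upto k O (fun x => a *: f x + g x).
Proof.
move=> oO; elim: k f g => [|k IH] f g hf hg.
  move=> x Ox; apply: (@continuousD _ _ _ (fun x => a *: f x)); last exact: hg.
  by apply: continuousZl_tmp; exact: hf.
have [[df Df] [dg Dg]] := (hf, hg).
have daf x : O x -> differentiable (fun x => a *: f x) x.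
  by move=> Ox; apply: differentiableZ; exact: df.
split=> [x Ox|v].
  by apply: (@differentiableD _ _ _ (fun x => a *: f x)); [exact: daf|exact: dg].
apply: differentiable_upto_ext oO _ (IH _ _ (Df v) (Dg v)) => x Ox.
rewrite (@deriveD _ _ _ (fun x => a *: f x)) ?deriveZ //;
  apply: diff_derivable; by [exact: df | exact: dg | exact: daf].
Qed.

(** By induction on [k]: the product rule writes a derivative of [B f g] as a
    sum of two terms of the same shape, each with one factor differentiated;
    the other factor then loses one order of differentiability. *)
Lemma differentiable_upto_bilinear {U' V W : normedModType R}
    (B : {bilinear U' -> V -> W}) k O (f : U -> U') (g : U -> V) :
  continuous (fun p => B p.1 p.2) -> open O ->
  differentiable_upto k O f -> differentiable_upto k O g ->
  differentiable_upto k O (fun x => B (f x) (g x)).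
Proof.
move=> cB oO; elim: k f g => [|k IH] f g hf hg.
  move=> x Ox.
  apply: (@continuous_comp _ _ _ (fun y => (f y, g y)) (fun p => B p.1 p.2)).
    by apply: cvg_pair; [exact: hf | exact: hg].
  exact: cB.
have [[df Df] [dg Dg]] := (hf, hg).
split=> [x Ox|v].
  by apply: (differentiable_bilinear_comp cB); [exact: df | exact: dg].
have [f' g'] := (differentiable_uptoW hf, differentiable_uptoW hg).
apply: differentiable_upto_ext oO _
  (differentiable_upto_lincomb 1 oO (IH _ _ (Df v) g') (IH _ _ f' (Dg v))).
by move=> x Ox; rewrite scale1r (derive_bilinear v cB (df x Ox) (dg x Ox)).
Qed.

Lemma differentiable_upto_linear {V W : normedModType R}
    (A : {linear V -> W}) k O (f : U -> V) :
  continuous A -> open O ->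
  differentiable_upto k O f -> differentiable_upto k O (A \o f).
Proof.
move=> cA oO; elim: k f => [|k IH] f hf.
  by move=> x Ox; apply: continuous_comp; [exact: hf | exact: cA].
have [df Df] := hf.
have dA y : differentiable A y by exact: linear_differentiable.
have dAf x : O x -> differentiable (A \o f) x.
  by move=> Ox; apply: differentiable_comp => //; exact: df.
split=> // v; apply: differentiable_upto_ext oO _ (IH _ (Df v)) => x Ox /=.
have [dfx dAfx] := (df x Ox, dAf x Ox).
rewrite !deriveE // (diff_comp (g := A)) //=.
by rewrite (diff_lin _ cA).
Qed.

Lemma differentiable_upto_cst {V : normedModType R} k O (c : V) :
  differentiable_upto k O (cst c).
Proof.
elim: k c => [|k IH] c; first by move=> x _; exact: cst_continuous.
split=> [x _|v]; first exact: differentiable_cst.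
suff -> : 'D_v (cst c) = cst 0 by exact: IH.
by apply/funext => x; rewrite derive_cst.
Qed.

End UptoClosure.

(** * Calculus of matrix-valued maps *)

Section MatrixCalculus.
Set Implicit Arguments.
Unset Strict Implicit.
Context {R : realType}.

Lemma continuous_mx {T : topologicalType} {m n} (f : T -> 'M[R]_(m.+1, n.+1)) x :
  (forall i j, {for x, continuous (fun y => f y i j)}) -> {for x, continuous f}.
Proof.
move=> cf; apply/cvgrPdist_le => e e0; near=> y.
rewrite /Num.Def.normr/= mx_normrE (bigmax_le _ (ltW e0))//= => ij _.
rewrite !mxE/=; move: ij; near: y; apply: filter_forall => /= ij.
exact: ((cvgrPdist_le _ _).1 (cf ij.1 ij.2)).
Unshelve. all: by end_near. Qed.

Lemma continuous_mulmx m n p :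
  continuous (fun AB : 'M[R]_(m.+1, n.+1) * 'M[R]_(n.+1, p.+1) => AB.1 *m AB.2).
Proof.
move=> AB; apply: continuous_mx => i j.
rewrite (_ : (fun _ => _) = fun y : 'M[R]_(m.+1, n.+1) * 'M[R]_(n.+1, p.+1) =>
  \sum_k y.1 i k * y.2 k j); last by apply/funext => y; rewrite mxE.
apply: cvg_big => [|k _]; first exact: add_continuous.
apply: continuousM.
  apply: (@continuous_comp _ _ _ fst (fun A : 'M[R]_(m.+1, n.+1) => A i k)).
    exact: cvg_fst.
  exact: coord_continuous.
apply: (@continuous_comp _ _ _ snd (fun A : 'M[R]_(n.+1, p.+1) => A k j)).
  exact: cvg_snd.
exact: coord_continuous.
Qed.

Lemma continuous_trmx m n : continuous (@trmx R m.+1 n.+1).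
Proof.
move=> A; apply: continuous_mx => i j.
rewrite (_ : (fun _ => _) = fun y : 'M[R]_(m.+1, n.+1) => y j i).
  exact: coord_continuous.
by apply/funext => y; rewrite mxE.
Qed.

(** The type records the bilinear structure over the vector space structure
    that underlies the norm, so that the bilinear lemmas apply without
    comparing the two structures again. *)
Definition mulmx_bilinear m n p :
    {bilinear 'M[R]_(m.+1, n.+1) -> 'M[R]_(n.+1, p.+1) -> 'M[R]_(m.+1, p.+1)} :=
  @mulmx R m.+1 n.+1 p.+1.

Context {U : normedModType R}.

Lemma derive_mulmx {m n p} (f : U -> 'M[R]_(m.+1, n.+1))
    (g : U -> 'M[R]_(n.+1, p.+1)) x v :
  differentiable f x -> differentiable g x ->
  'D_v (fun y => f y *m g y) x = 'D_v f x *m g x + f x *m 'D_v g x.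
Proof. exact/(derive_bilinear (B := mulmx_bilinear _ _ _))/continuous_mulmx. Qed.

Lemma differentiable_mulmx {m n p} (f : U -> 'M[R]_(m.+1, n.+1))
    (g : U -> 'M[R]_(n.+1, p.+1)) x :
  differentiable f x -> differentiable g x ->
  differentiable (fun y => f y *m g y) x.
Proof.
exact/(differentiable_bilinear_comp (B := mulmx_bilinear _ _ _))/continuous_mulmx.
Qed.

Lemma Cinfty_mulmx {m n p} O (f : U -> 'M[R]_(m.+1, n.+1))
    (g : U -> 'M[R]_(n.+1, p.+1)) :
  open O -> Cinfty_on O f -> Cinfty_on O g ->
  Cinfty_on O (fun y => f y *m g y).
Proof.
move=> oO hf hg k.
apply: (differentiable_upto_bilinear (B := mulmx_bilinear _ _ _)) => //.
exact: continuous_mulmx.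
Qed.

Lemma Cinfty_trmx {m n} O (f : U -> 'M[R]_(m.+1, n.+1)) :
  open O -> Cinfty_on O f -> Cinfty_on O (fun y => (f y)^T).
Proof.
move=> oO hf k; apply: (@differentiable_upto_linear _ _ _ _ trmx) => //.
exact: continuous_trmx.
Qed.

Lemma Cinfty_lincomb {V : normedModType R} O (a : R) (f g : U -> V) :
  open O -> Cinfty_on O f -> Cinfty_on O g ->
  Cinfty_on O (fun y => a *: f y + g y).
Proof. by move=> oO hf hg k; exact: differentiable_upto_lincomb. Qed.

Lemma Cinfty_differentiable {V : normedModType R} O (f : U -> V) x :
  Cinfty_on O f -> O x -> differentiable f x.
Proof. by move=> /(_ 1%N)[+ _] => /[apply]. Qed.

End MatrixCalculus.

(** * Lorentzian linear algebra *)

Section LorentzAlgebra.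
Set Implicit Arguments.
Unset Strict Implicit.
Context {R : realType} {n : nat}.
Implicit Types (G A B : 'M[R]_n.+2) (u v w : 'cV[R]_n.+2).

Lemma lorentzian_unitmx G : lorentzian G -> G \in unitmx.
Proof.
move=> [P _ PGP].
have : P^T *m G *m P \in unitmx.
  rewrite PGP unitmxE det_diag unitfE; apply/prodf_neq0 => i _.
  by rewrite mxE; case: ifP => _; rewrite ?oppr_eq0 oner_neq0.
by rewrite !unitmx_mul => /andP[/andP[]].
Qed.

Lemma lorentzian_sym G : lorentzian G -> G^T = G.
Proof.
move=> [P uP PGP]; have uPT : P^T \in unitmx by rewrite unitmx_tr.
have E : P^T *m (G^T *m P) = P^T *m (G *m P).
  rewrite [RHS]mulmxA PGP -[RHS]tr_diag_mx -PGP.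
  by rewrite !trmx_mul trmxK mulmxA.
have := congr1 (mulmx (invmx P^T)) E; rewrite !mulKmx //.
by move/(congr1 (mulmx^~ (invmx P))); rewrite !mulmxK.
Qed.

Lemma mulmx_ext {m p} (A B : 'M[R]_(m, p)) :
  (forall w : 'cV[R]_p, A *m w = B *m w) -> A = B.
Proof.
move=> AB; apply/matrixP => i j; have := AB (delta_mx j 0).
by rewrite -!colE => /colP /(_ i); rewrite !mxE.
Qed.

Lemma mulmx_ip G u v : u^T *m G *m v = (ip G u v)%:M.
Proof. exact: mx11_scalar. Qed.

Lemma ipC G u v : G^T = G -> ip G u v = ip G v u.
Proof.
move=> GT; have : ((ip G u v)%:M : 'M[R]_1)^T = (ip G v u)%:M.
  by rewrite -!mulmx_ip !trmx_mul trmxK GT mulmxA.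
by rewrite tr_scalar_mx => /matrixP /(_ 0 0); rewrite !mxE.
Qed.

Lemma ipZr G u v (a : R) : ip G u (a *: v) = a * ip G u v.
Proof. by rewrite /ip -scalemxAr mxE. Qed.

Lemma ipZl G u v (a : R) : ip G (a *: u) v = a * ip G u v.
Proof. by rewrite /ip [(a *: u)^T]linearZ /= -!scalemxAl mxE. Qed.

Lemma wedge_mul G u v w :
  wedge G u v *m w = ip G u w *: v - ip G v w *: u.
Proof.
by rewrite /wedge mulmxBl -!mulmxA !(mulmxA _ G) !mulmx_ip !mul_mx_scalar.
Qed.

(** For u in L and v orthogonal to L, both (u,w) and (v,w) vanish when w is in
    the isotropic space L. *)
Lemma in_wedge_perp_kills G (L : {vspace 'cV[R]_n.+2}) A w :
  G^T = G -> (forall u v, u \in L -> v \in L -> ip G u v = 0) ->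
  in_wedge_perp G L A -> w \in L -> A *m w = 0.
Proof.
move=> GT Lnull [u [v [uL vL ->]]] wL.
by rewrite wedge_mul Lnull // ipC // vL // !scale0r subrr.
Qed.

Lemma line_collinear (L : {vspace 'cV[R]_n.+2}) u u' :
  \dim L = 1%N -> u \in L -> u' \in L ->
  exists F a a', [/\ F \in L, u = a *: F & u' = a' *: F].
Proof.
move=> L1; have F0 : vpick L != 0 by rewrite vpick0 -dimv_eq0 L1.
have <- : <[vpick L]>%VS = L.
  by apply/eqP; rewrite eqEdim dim_vline F0 L1 -memvE memv_pick.
by move=> /vlineP[a ->] /vlineP[a' ->]; exists (vpick L), a, a';
  rewrite memv_line.
Qed.

Lemma line_isotropic G (L : {vspace 'cV[R]_n.+2}) u v : \dim L = 1%N ->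
  (forall u, u \in L -> ip G u u = 0) -> u \in L -> v \in L -> ip G u v = 0.
Proof.
move=> L1 Lnull uL vL; have [F [a [b [FL -> ->]]]] := line_collinear L1 uL vL.
by rewrite ipZl ipZr Lnull // !mulr0.
Qed.

(** For F spanning L and a, b orthogonal to F, the composition of wedge F a and
    wedge F b maps w to - (F,w) (a,b) F, which is symmetric in a and b. *)
Lemma in_wedge_perp_comm G (L : {vspace 'cV[R]_n.+2}) A B :
  G^T = G -> \dim L = 1%N -> (forall u v, u \in L -> v \in L -> ip G u v = 0) ->
  in_wedge_perp G L A -> in_wedge_perp G L B -> A *m B = B *m A.
Proof.
move=> GT L1 Lnull hA hB; have [u [v [uL vL eA]]] := hA.
have [u' [v' [u'L v'L eB]]] := hB.
have AL := in_wedge_perp_kills GT Lnull hA u'L.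
have BL := in_wedge_perp_kills GT Lnull hB uL.
apply: mulmx_ext => w; rewrite -!mulmxA {1}eB {2}eA !wedge_mul !mulmxBr -!scalemxAr.
rewrite AL BL !scaler0 !subr0 eA eB !wedge_mul v'L // vL // !scale0r !sub0r.
rewrite (ipC v' v) // !scalerN !scalerA.
have [F [a [a' [_ -> ->]]]] := line_collinear L1 uL u'L.
rewrite !scalerA !ipZl; congr (- (_ *: _)).
by ring.
Qed.

Lemma isometry_mx G A : (forall u v, ip G (A *m u) (A *m v) = ip G u v) ->
  A^T *m G *m A = G.
Proof.
move=> isoA; apply: mulmx_ext => w; apply: trmx_inj; apply: mulmx_ext => u.
apply: trmx_inj; rewrite !trmx_mul !trmxK.
rewrite [RHS]mulmxA mulmx_ip -isoA -mulmx_ip trmx_mul.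
by rewrite !mulmxA.
Qed.

Lemma isometry_unitmx G A : G \in unitmx ->
  (forall u v, ip G (A *m u) (A *m v) = ip G u v) -> A \in unitmx.
Proof.
by move=> uG /isometry_mx AGA; move: uG; rewrite -{1}AGA !unitmx_mul => /andP[].
Qed.

(** This formula has no inverse that depends on [A], so it shows that the
    inverse of a smooth family of isometries is smooth. *)
Lemma isometry_invmx G A : G \in unitmx ->
  (forall u v, ip G (A *m u) (A *m v) = ip G u v) ->
  invmx A = invmx G *m A^T *m G.
Proof.
move=> uG isoA; have uA := isometry_unitmx uG isoA.
have E : invmx G *m A^T *m G *m A = 1%:M.
  by rewrite -2!(mulmxA (invmx G)) isometry_mx // mulVmx.
by rewrite -[RHS](mulmxK uA) E mul1mx.
Qed.

Lemma wedge_isometry G A u v : A \in unitmx ->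
  (forall u v, ip G (A *m u) (A *m v) = ip G u v) ->
  A *m wedge G u v *m invmx A = wedge G (A *m u) (A *m v).
Proof.
move=> uA isoA; apply: mulmx_ext => w.
have -> : w = A *m (invmx A *m w) by rewrite mulKVmx.
move: (invmx A *m w) => {}w.
by rewrite -mulmxA mulKmx // -mulmxA !wedge_mul mulmxBr !isoA -!scalemxAr.
Qed.

End LorentzAlgebra.

(** * Smooth maps on a surface *)

Section SurfaceCalculus.
Set Implicit Arguments.
Unset Strict Implicit.
Context {R : realType} {S : topologicalType} {M : smooth_surface R S}.
Implicit Types (i : atlas M) (W : set S).

(** [chart i @` dom i] is open and [param i] is continuous on it, so
    [param i @^-1` W] cuts out a neighbourhood of each point of the image. *)
Lemma chart_image_open W i : open W -> open (chart i @` (W `&` dom i)).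
Proof.
move=> oW; rewrite openE => _ [x [Wx ix] <-].
have im : (chart i @` dom i) (chart i x) by exists x.
have pW : nbhs (chart i x) (param i @^-1` W).
  by apply: (param_continuous im); rewrite chartK //; exact: open_nbhs_nbhs.
have nim := open_nbhs_nbhs (conj (@image_open _ _ M i) im).
apply: filterS (filterI pW nim) => y /= [Wy [z iz zy]].
by exists z => //; split=> //; move: Wy; rewrite -zy chartK.
Qed.

Lemma smooth_sub {V : normedModType R} W (f : S -> V) :
  smooth M f -> smooth_on M W f.
Proof.
move=> sf i k; apply: differentiable_upto_sub (sf i k) => _ [x [_ ix] <-].
by exists x.
Qed.

Lemma smooth_cst {V : normedModType R} (c : V) : smooth M (cst c).
Proof. by move=> i k; exact: differentiable_upto_cst. Qed.

Lemma smooth_lincomb {V : normedModType R} (a : R) (f g : S -> V) :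
  smooth M f -> smooth M g -> smooth M (fun x => a *: f x + g x).
Proof.
move=> sf sg i.
by apply: (Cinfty_lincomb a _ (sf i) (sg i)); apply: chart_image_open; exact: openT.
Qed.

Lemma smooth_on_mulmx {m n p} W (f : S -> 'M[R]_(m.+1, n.+1))
    (g : S -> 'M[R]_(n.+1, p.+1)) : open W ->
  smooth_on M W f -> smooth_on M W g -> smooth_on M W (fun x => f x *m g x).
Proof.
by move=> oW sf sg i; exact/(Cinfty_mulmx _ (sf i) (sg i))/chart_image_open.
Qed.

Lemma smooth_trmx {m n} (f : S -> 'M[R]_(m.+1, n.+1)) :
  smooth M f -> smooth M (fun x => (f x)^T).
Proof.
by move=> sf i; apply: (Cinfty_trmx _ (sf i)); exact/chart_image_open/openT.
Qed.

Lemma smooth_on_differentiable {V : normedModType R} W (f : S -> V) i x :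
  smooth_on M W f -> W x -> dom i x -> differentiable (f \o param i) (chart i x).
Proof. by move=> sf Wx ix; apply: Cinfty_differentiable (sf i) _; exists x. Qed.

Lemma d_form_mulmx {m n p} (f : S -> 'M[R]_(m.+1, n.+1))
    (g : S -> 'M[R]_(n.+1, p.+1)) i x v : dom i x ->
  differentiable (f \o param i) (chart i x) ->
  differentiable (g \o param i) (chart i x) ->
  d_form (M := M) (fun y => f y *m g y) i x v =
  d_form (M := M) f i x v *m g x + f x *m d_form (M := M) g i x v.
Proof.
by move=> ix df dg; rewrite /d_form (derive_mulmx v df dg) /= chartK.
Qed.

Lemma d_form_cst {V : normedModType R} (c : V) i x v :
  d_form (M := M) (cst c) i x v = 0.
Proof. exact: derive_cst. Qed.

End SurfaceCalculus.

(** * Shifting the parameter of a polynomial of sections *)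

Section TaylorShift.
Set Implicit Arguments.
Unset Strict Implicit.
Context {R : realType} {n : nat} {S : topologicalType}.
Implicit Types (p : seq (bundle_section R n S)) (s t : R).

(** The coefficient of t^k in p(t + s). *)
Definition shift_coef p s k : bundle_section R n S :=
  fun x => \sum_(j < size p) (s ^+ (j - k) *+ 'C(j, k)) *: pcoef p j x.

(** The coefficients of t |-> Phi p(t + s). *)
Definition gauge_shift (Phi : S -> 'M[R]_n.+2) p s : seq (bundle_section R n S) :=
  mkseq (fun k x => Phi x *m shift_coef p s k x) (size p).

Lemma pcoef_gauge_shift Phi p s k x :
  pcoef (gauge_shift Phi p s) k x = Phi x *m shift_coef p s k x.
Proof.
rewrite /pcoef; case: (ltnP k (size p)) => kp; first by rewrite nth_mkseq.
rewrite nth_default ?size_mkseq // /shift_coef big1 ?mulmx0 // => j _.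
by rewrite bin_small ?mulr0n ?scale0r // (leq_trans (ltn_ord j)).
Qed.

Lemma shift_coef0 p s x : shift_coef p s 0 x = peval p s x.
Proof. by apply: eq_bigr => j _; rewrite subn0 bin0. Qed.

Lemma peval_gauge_shift Phi p s t x :
  peval (gauge_shift Phi p s) t x = Phi x *m peval p (t + s) x.
Proof.
rewrite /peval size_mkseq mulmx_sumr.
under eq_bigr => k _ do
  rewrite pcoef_gauge_shift scalemxAr /shift_coef scaler_sumr mulmx_sumr.
rewrite exchange_big /=; apply: eq_bigr => j _.
rewrite -mulmx_sumr; congr (_ *m _).
under eq_bigr => k _ do rewrite scalerA.
rewrite -scaler_suml; congr (_ *: _).
(* The missing terms k > j have a zero binomial coefficient. *)
rewrite addrC exprDn (big_ord_widen _
  (fun k => s ^+ (j - k) * t ^+ k *+ 'C(j, k)) (ltn_ord j)).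
rewrite [RHS]big_mkcond; apply: eq_bigr => k _ /=.
case: ltnP => jk; first by rewrite mulrnAr mulrC.
by rewrite bin_small // mulr0n mulr0.
Qed.

(** From the degree on, the only term that survives is j = k: smaller j have a
    zero binomial coefficient, larger j have a zero [pcoef p j]. *)
Lemma shift_coef_top p s d k x : (d <= k)%N ->
  (forall j, (d < j)%N -> forall y, pcoef p j y = 0) ->
  shift_coef p s k x = pcoef p k x.
Proof.
move=> dk hd; have zero (j : nat) : (j != k)%N ->
    (s ^+ (j - k) *+ 'C(j, k)) *: pcoef p j x = 0.
  rewrite neq_ltn => /orP[jk|kj].
    by rewrite bin_small // mulr0n scale0r.
  by rewrite hd ?scaler0 // (leq_ltn_trans dk).
rewrite /shift_coef; case: (ltnP k (size p)) => kp.
  rewrite (bigD1 (Ordinal kp)) //= big1 => [|j jk]; last exact: zero.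
  by rewrite subnn binn expr0 mulr1n scale1r addr0.
rewrite big1 => [|j _]; first by rewrite /pcoef nth_default.
by apply: zero; rewrite neq_ltn (leq_trans (ltn_ord j)).
Qed.

Lemma smooth_shift_coef (M : smooth_surface R S) p s k :
  (forall j, smooth M (pcoef p j)) -> smooth M (shift_coef p s k).
Proof.
move=> sp; rewrite /shift_coef.
suff H (N : nat) (c : 'I_N -> R) (j : 'I_N -> nat) :
    smooth M (fun x => \sum_(l < N) c l *: pcoef p (j l) x) by exact: H.
elim: N c j => [|N IH] c j.
  rewrite (_ : (fun _ => _) = cst 0); first exact: smooth_cst.
  by apply/funext => x; rewrite big_ord0.
under eq_fun do rewrite big_ord_recl.
by apply: smooth_lincomb => //; exact: IH.
Qed.

End TaylorShift.

(** * Gauge transformations of isothermic surfaces *)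

Section TTransform.
Set Implicit Arguments.
Unset Strict Implicit.
Context {R : realType} {n : nat} {G : 'M[R]_n.+2} (hG : lorentzian G).
Context {S : topologicalType} {M : smooth_surface R S}.
Context {s : R} {L : line_field R n S} {eta : o_form n M} {Phi : S -> 'M[R]_n.+2}.
Context (hiso : isothermic G L eta) (gPhi : orthogonal_gauge G M Phi).
Context (tPhi : trivializes s eta Phi).

Let Psi x := invmx (Phi x).
Let smooth_Phi : smooth M Phi := gPhi.1.
Let isometry_Phi x := gPhi.2 x.
Let unit_Phi x : Phi x \in unitmx :=
  isometry_unitmx (lorentzian_unitmx hG) (isometry_Phi x).

Lemma isometry_Psi x u v : ip G (Psi x *m u) (Psi x *m v) = ip G u v.
Proof. by rewrite -(isometry_Phi x) !mulKVmx. Qed.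

Lemma smooth_Psi : smooth M Psi.
Proof.
rewrite (_ : Psi = fun x => invmx G *m (Phi x)^T *m G); last first.
  apply/funext => x.
  exact: isometry_invmx (lorentzian_unitmx hG) (isometry_Phi x).
apply: smooth_on_mulmx; [exact: openT| |exact: smooth_cst].
apply: smooth_on_mulmx; [exact: openT|exact: smooth_cst|].
exact: smooth_trmx.
Qed.

(** A constant section c satisfies d c = 0, so d + s eta annihilates Psi c; as
    c is arbitrary, this is an equation between matrices. *)
Lemma d_form_Psi i x v : dom i x ->
  d_form (M := M) Psi i x v = - s *: (eta i x v *m Psi x).
Proof.
move=> ix; apply: mulmx_ext => c; apply/eqP; rewrite scaleNr mulNmx -addr_eq0.
have := tPhi (smooth_cst c) v ix.
have -> : connection s eta (fun y => invmx (Phi y) *m cst c y) i x v =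
    d_form (M := M) Psi i x v *m c + (s *: (eta i x v *m Psi x)) *m c.
  rewrite /connection (d_form_mulmx _ ix); first last.
  - exact: smooth_on_differentiable (smooth_cst c) I ix.
  - exact: smooth_on_differentiable smooth_Psi I ix.
  by rewrite d_form_cst mulmx0 addr0 -scalemxAl mulmxA.
by rewrite d_form_cst => /(congr1 (mulmx (Psi x))); rewrite mulKmx // mulmx0 => ->.
Qed.

(** Differentiate Phi Psi = 1. *)
Lemma d_form_Phi i x v : dom i x ->
  d_form (M := M) Phi i x v = s *: (Phi x *m eta i x v).
Proof.
move=> ix; have : d_form (M := M) (fun y => Phi y *m Psi y) i x v = 0.
  rewrite (_ : (fun _ => _) = cst 1%:M) ?d_form_cst //.
  by apply/funext => y; rewrite mulmxV.
rewrite (d_form_mulmx _ ix); first last.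
- exact: smooth_on_differentiable smooth_Psi I ix.
- exact: smooth_on_differentiable smooth_Phi I ix.
rewrite d_form_Psi // scaleNr mulmxN => /eqP; rewrite subr_eq0 => /eqP.
move/(congr1 (mulmx^~ (Phi x))); rewrite mulmxKV // => ->.
by rewrite -scalemxAr -scalemxAl mulmxA mulmxKV.
Qed.

(** The relation Phi o (d + (t + s) eta) = (d + t eta_s) o Phi on local
    sections. *)
Lemma gauge_connection W (f : bundle_section R n S) t i x v :
  smooth_on M W f -> W x -> dom i x ->
  connection t (gauge_form Phi eta) (fun y => Phi y *m f y) i x v =
  Phi x *m connection (t + s) eta f i x v.
Proof.
move=> sf Wx ix; rewrite /connection (d_form_mulmx _ ix); first last.
- exact: smooth_on_differentiable sf Wx ix.
- exact: smooth_on_differentiable smooth_Phi I ix.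
rewrite d_form_Phi // /gauge_form -!mulmxA mulKmx // mulmxDr.
by rewrite -scalemxAl -scalemxAr -!mulmxA addrAC -scalerDl addrC (addrC s).
Qed.

Let G_sym : G^T = G := lorentzian_sym hG.
Let line_L x : \dim (L x) = 1%N.
Proof. by case: hiso => [[[]]]. Qed.

Let null_L x u v : u \in L x -> v \in L x -> ip G u v = 0.
Proof. by apply: line_isotropic => // w; case: hiso => [[[_ nL _] _] _]; exact: nL. Qed.

Let wedge_eta i x v : dom i x -> in_wedge_perp G (L x) (eta i x v).
Proof. by case: hiso => [_ [_ _ _ _ h]]; exact: h. Qed.

Lemma mem_gauge_line x u : (Phi x *m u \in gauge_line Phi L x) = (u \in L x).
Proof.
apply/idP/idP => [/memv_imgP[w wL]|uL].
  by rewrite lfunE /= => /(congr1 (mulmx (Psi x))); rewrite !mulKmx // => ->.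
by apply/memv_imgP; exists u; rewrite ?lfunE.
Qed.

Lemma gauge_lineE x u : (u \in gauge_line Phi L x) = (Psi x *m u \in L x).
Proof. by rewrite -mem_gauge_line mulKVmx. Qed.

Lemma dim_limg_Phi x (U : {vspace 'cV[R]_n.+2}) :
  \dim (linfun (mulmx (Phi x) : 'cV[R]_n.+2 -> 'cV[R]_n.+2) @: U) = \dim U.
Proof.
apply: limg_dim_eq; rewrite (_ : lker _ = 0%VS) ?capv0 //.
apply/eqP; rewrite -subv0; apply/subvP => u.
rewrite memv_ker lfunE /= memv0 => /eqP/(congr1 (mulmx (Psi x))).
by rewrite mulKmx // mulmx0 => ->.
Qed.

Lemma dim_line_sum_Phi x (a b c : 'cV[R]_n.+2) :
  \dim (<[Phi x *m a]> + <[Phi x *m b]> + <[Phi x *m c]>) =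
  \dim (<[a]> + <[b]> + <[c]>).
Proof. by rewrite -[RHS](dim_limg_Phi x) !limgD !limg_line !lfunE. Qed.

Lemma gauge_lift W F : open W -> lift_on M W L F ->
  lift_on M W (gauge_line Phi L) (fun x => Phi x *m F x).
Proof.
move=> oW [sF lF]; split=> [|x /lF[F0 FL]].
  exact: smooth_on_mulmx oW (smooth_sub _ smooth_Phi) sF.
rewrite mem_gauge_line; split=> //; apply: contra_neq F0.
by move/(congr1 (mulmx (Psi x))); rewrite mulKmx // mulmx0.
Qed.

Lemma ungauge_lift W F : open W -> lift_on M W (gauge_line Phi L) F ->
  lift_on M W L (fun x => Psi x *m F x).
Proof.
move=> oW [sF lF]; split=> [|x /lF[F0 FL]].
  exact: smooth_on_mulmx oW (smooth_sub _ smooth_Psi) sF.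
rewrite -gauge_lineE; split=> //; apply: contra_neq F0.
by move/(congr1 (mulmx (Phi x))); rewrite mulKVmx // mulmx0.
Qed.

(** The lifts of the transformed bundle are exactly Phi F for lifts F of L.
    As eta F = 0, [d (Phi F) = Phi (d F)], so the span of a lift and its
    derivatives is mapped isomorphically by Phi. *)
Lemma gauge_immersion : immersion G M (gauge_line Phi L).
Proof.
have [[[L1 nL lL] imL] _] := hiso; split.
  split=> [x|x u|x].
  - by rewrite dim_limg_Phi.
  - by rewrite gauge_lineE => /nL; rewrite isometry_Psi.
  - have [W [F [oW Wx lF]]] := lL x.
    by exists W, (fun x => Phi x *m F x); split=> //; exact: gauge_lift.
move=> W F oW lF i x Wx ix.
have lF' := ungauge_lift oW lF; have [sF' /(_ x Wx)[_ F'L]] := lF'.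
have dF v : d_form (M := M) F i x v =
    Phi x *m d_form (M := M) (fun y => Psi y *m F y) i x v.
  (* At t = - s the connection on the right is the trivial one. *)
  have := gauge_connection (- s) v sF' Wx ix; rewrite addNr /connection.
  rewrite scale0r addr0 => <-.
  rewrite (_ : (fun _ => _) = F); last by apply/funext => y; rewrite mulKVmx.
  rewrite /gauge_form -!mulmxA.
  rewrite mulKmx // (in_wedge_perp_kills G_sym (@null_L x) (wedge_eta v ix) F'L).
  by rewrite mulmx0 scaler0 addr0.
have FE : F x = Phi x *m (Psi x *m F x) by rewrite mulKVmx.
rewrite !dF FE dim_line_sum_Phi.
exact: imL W _ oW lF' i x Wx ix.
Qed.

(** For closedness, the product rule gives, on tangent vectors u and v, that
    d eta_s = Phi (d eta) Psi + 2 s Phi [eta u, eta v] Psi; the bracket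
    vanishes because the values of eta at a point commute. *)
Lemma gauge_isothermic : isothermic G (gauge_line Phi L) (gauge_form Phi eta).
Proof.
split; first exact: gauge_immersion.
have [_ [[eta_lin eta_chart eta_smooth] eta_closed
  [i0 [x0 [v0 [ix0 eta0]]]] eta_o _]] := hiso.
split.
- split=> [i x ix a u v|i j x ix jx v|i v].
  + by rewrite /gauge_form eta_lin // mulmxDr mulmxDl -scalemxAr -scalemxAl.
  + by rewrite /gauge_form (eta_chart i j x).
  + have oi := @image_open _ _ M i.
    have smooth_dom (f : S -> 'M[R]_n.+2) : smooth M f ->
        Cinfty_on (chart i @` dom i) (f \o param i).
      by move=> /(_ i); rewrite setTI.
    apply: (Cinfty_mulmx oi _ (smooth_dom _ smooth_Psi)).
    exact: Cinfty_mulmx oi (smooth_dom _ smooth_Phi) (eta_smooth i v).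
- move=> i x ix.
  have deta v : differentiable (fun y => eta i (param i y) v) (chart i x).
    by apply: Cinfty_differentiable (eta_smooth i v) _; exists x.
  have dPhi := smooth_on_differentiable smooth_Phi I ix.
  have dPsi := smooth_on_differentiable smooth_Psi I ix.
  have D u v : 'D_u (fun y => gauge_form Phi eta i (param i y) v) (chart i x) =
      Phi x *m 'D_u (fun y => eta i (param i y) v) (chart i x) *m Psi x +
      s *: (Phi x *m (eta i x u *m eta i x v - eta i x v *m eta i x u) *m Psi x).
    rewrite (derive_mulmx u (differentiable_mulmx dPhi (deta v)) dPsi).
    rewrite (derive_mulmx u dPhi (deta v)) /= chartK //.
    rewrite -[X in X *m eta i x v]/(d_form (M := M) Phi i x u) d_form_Phi //.
    rewrite -[X in _ + _ *m X]/(d_form (M := M) Psi i x u) d_form_Psi //.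
    rewrite mulmxDl mulmxBr mulmxBl scalerBr scaleNr mulmxN -!scalemxAr.
    by rewrite -!scalemxAl !mulmxA addrAC addrC addrA.
  move=> u v; rewrite [LHS]D [RHS]D (in_wedge_perp_comm G_sym (line_L x)
    (@null_L x) (wedge_eta u ix) (wedge_eta v ix)) !subrr.
  exact: (congr1 (fun X => Phi x *m X *m Psi x + _) (eta_closed i x ix u v)).
- exists i0, x0, v0; split=> // /(congr1 (fun A => Psi x0 *m A *m Phi x0)).
  rewrite /gauge_form mulmx0 mul0mx -!mulmxA mulKmx // mulVmx // mulmx1.
  exact: eta0.
- move=> i x v ix a b; rewrite /gauge_form -!mulmxA.
  rewrite -(isometry_Psi x) -[X in _ + X](isometry_Psi x) !mulKmx //.
  exact: eta_o.
- move=> i x v ix; have [a [b [aL bL eE]]] := wedge_eta v ix.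
  exists (Phi x *m a), (Phi x *m b); rewrite mem_gauge_line; split=> //.
    by move=> u; rewrite gauge_lineE => /bL; rewrite -(isometry_Phi x) mulKVmx.
  by rewrite /gauge_form eE wedge_isometry.
Qed.

Lemma gauge_special_isothermic d p : special_isothermic G L eta d p ->
  special_isothermic G (gauge_line Phi L) (gauge_form Phi eta) d
    (gauge_shift Phi p s).
Proof.
move=> [_ [_ sp cp] [[x0 px0] hd]].
have nz : pcoef (gauge_shift Phi p s) d x0 <> 0.
  rewrite pcoef_gauge_shift (shift_coef_top _ _ (leqnn d)) //.
  by move/(congr1 (mulmx (Psi x0))); rewrite mulKmx // mulmx0.
split; first exact: gauge_isothermic.
- split; first by exists d, x0.
  + move=> k.
    rewrite (_ : pcoef _ k = fun x => Phi x *m shift_coef p s k x); last first.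
      by apply/funext => x; rewrite pcoef_gauge_shift.
    by apply: smooth_on_mulmx; [exact: openT | | exact: smooth_shift_coef].
  + move=> t i x v ix.
    rewrite (_ : peval _ t = fun x => Phi x *m peval p (t + s) x); last first.
      by apply/funext => y; rewrite peval_gauge_shift.
    rewrite (gauge_connection (W := setT)) ?cp ?mulmx0 //.
    rewrite (_ : peval p (t + s) = shift_coef p (t + s) 0).
      exact: smooth_shift_coef.
    by apply/funext => y; rewrite shift_coef0.
- split; first by exists x0.
  move=> k dk x; rewrite pcoef_gauge_shift (shift_coef_top _ _ (ltnW dk)) //.
  by rewrite hd // mulmx0.
Qed.

End TTransform.

Theorem theorem3p12 (R : realType) (n : nat) (hn : (3 <= n)%N)
    (G : 'M[R]_n.+2) (hG : lorentzian G)
    (S : topologicalType) (M : smooth_surface R S) (hS : connected [set: S])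
    (s : R) (L Ls : line_field R n S)
    (eta etas : o_form n M) (Phi : S -> 'M[R]_n.+2)
    (hiso : isothermic G L eta)
    (hT : T_transform G s Phi L eta Ls etas)
    (d : nat) (p : seq (bundle_section R n S))
    (hp : special_isothermic G L eta d p) :
  exists q : seq (bundle_section R n S),
    special_isothermic G Ls etas d q /\
    (forall x, pcoef q 0 x = Phi x *m peval p s x).
Proof.
have [gPhi tPhi -> ->] := hT.
exists (gauge_shift Phi p s); split; first exact: (gauge_special_isothermic hG).
by move=> x; rewrite pcoef_gauge_shift shift_coef0.
Qed.
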